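(* Let $G$ be a (discrete) countably infinite abelian group. Let $c\in(0,1)$, and let $\Phi$ be a Følner sequence in $G$. Then there is a Straus set $A\subseteq G$ such that $d_\Phi(A)=c$.
   Context: A (left) Følner sequence in $G$ is a sequence $\Phi=(\Phi_n)$ of nonempty finite subsets of $G$ with $\lim_{n\to\infty}|\Phi_n\cap g\Phi_n|/|\Phi_n|=1$ for every $g\in G$. For $A\subseteq G$, $\overline{d}_\Phi(A)=\limsup_{n\to\infty}|A\cap\Phi_n|/|\Phi_n|$ is the upper density, and $d_\Phi(A)=\lim_{n\to\infty}|A\cap\Phi_n|/|\Phi_n|$ when this limit exists (the assertion $d_\Phi(A)=c$ includes existence of the limit). A set $A\subseteq G$ is a set of (measurable) recurrence if for every probability space $(X,\mathcal{B},\mu)$ with a measure-preserving action of $G$ and every $Y\in\mathcal{B}$ with $\mu(Y)>0$, there is $g\in A$, not equal to the identity, such that $\mu(Y\cap gY)>0$. A set $A\subseteq G$ is an anti-recurrence (AR) set if for all $g\in G$ the translate $gA$ is not a set of recurrence. A Straus set is an AR set with positive upper density (with respect to some Følner sequence). *)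

(* Defs.v *)
From mathcomp Require Import all_boot all_order all_algebra finmap.
From mathcomp Require Import all_classical all_reals all_analysis.

Set Implicit Arguments.
Unset Strict Implicit.
Unset Printing Implicit Defensive.

Import Order.TTheory GRing.Theory Num.Theory.
Import numFieldNormedType.Exports.

Local Open Scope classical_set_scope.
Local Open Scope ring_scope.

(* Abelian groups are [zmodType]s, hence written additively: the translate gA
   is [set g + a | a in A] and the identity is 0. *)

Definition density_in (R : realType) (G : zmodType) (A : set G)
    (F : {fset G}) : R :=
  #|` [fset x in F | x \in A]%fset|%:R / #|` F|%:R.

Definition folner (R : realType) (G : zmodType) (Phi : nat -> {fset G}) : Prop :=
  (forall n, Phi n != fset0%fset) /\
  forall g : G,
    (#|` (Phi n `&` [fset (g + x)%R | x in Phi n])%fset|%:R / #|` Phi n|%:R : R)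
      @[n --> \oo] --> (1 : R).

Definition upper_density (R : realType) (G : zmodType)
    (Phi : nat -> {fset G}) (A : set G) : R :=
  limn_sup (fun n => density_in R A (Phi n)).

Definition has_density (R : realType) (G : zmodType)
    (Phi : nat -> {fset G}) (A : set G) (c : R) : Prop :=
  density_in R A (Phi n) @[n --> \oo] --> c.

Record mp_action (R : realType) (G : zmodType) (d : measure_display)
    (X : measurableType d) (mu : probability X R) (act : G -> X -> X) : Prop :=
  MpAction {
    mp_act0 : forall x, act 0 x = x ;
    mp_actD : forall g h x, act (g + h) x = act g (act h x) ;
    mp_act_measurable : forall g, measurable_fun setT (act g) ;
    mp_act_preserving : forall g (Y : set X), measurable Y ->
      mu (act g @^-1` Y) = mu Y }.

Definition recurrence_set (R : realType) (G : zmodType) (A : set G) : Prop :=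
  forall (d : measure_display) (X : measurableType d) (mu : probability X R)
         (act : G -> X -> X),
    mp_action mu act ->
    forall Y : set X, measurable Y -> (0 < mu Y)%E ->
    exists g : G, [/\ A g, g != 0 & (0 < mu (Y `&` act g @` Y))%E].

Definition anti_recurrence_set (R : realType) (G : zmodType) (A : set G) : Prop :=
  forall g : G, ~ recurrence_set R [set g + a | a in A].

Definition straus_set (R : realType) (G : zmodType) (A : set G) : Prop :=
  anti_recurrence_set R A /\
  exists Psi : nat -> {fset G}, folner R Psi /\ 0 < upper_density R Psi A.

(* Main.v *)
Require Import Defs.
From HB Require Import structures.
From mathcomp Require Import all_boot all_order all_algebra finmap.
From mathcomp Require Import all_classical all_reals all_analysis.
From mathcomp Require Import ring lra zify.

(** Call a set of group elements avoidable if some measure-preserving system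
    has a set [Y] of positive measure that no nonzero element of the set brings
    back to itself.  Avoidable sets are not sets of recurrence, they are closed
    under subsets, and also under finite unions: two systems that avoid [A] and
    [B] yield their product, which avoids both.

    Rotations of the circle provide avoidable sets.  If [chi] is a character of
    [G] with values in R/Z, then the elements [g] with [chi g] at distance at
    least [delta] from 0 never bring an arc of length [delta] back to itself.
    Characters separate the points of [G], so a finite union of such sets shows
    the key fact ([bohr_separation]): for every finite [F] there is a Bohr
    neighbourhood of 0 whose complement is avoidable and which contains no two
    distinct points with difference in [F].  Taking [F] large makes the Bohr
    neighbourhood sparse, uniformly over [G].  Moreover finite sets are
    avoidable ([avoidable_finite]).

    Enumerate [G] as [g 0], [g 1], ... and pick such neighbourhoods [bohr n].  If
    [A] meets each translate [E n = bohr n - g n] in a finite set only, then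
    [g n + A] is covered by the complement of [bohr n] and a finite set; hence no
    translate of [A] is a set of recurrence ([translates_avoidable]).  So it is
    enough to find [A] of density [c] that meets every [E n] in a finite set.

    This is done cell by cell.  Let [p 0], [p 1], ... label coarser and coarser
    partitions of [G] into finite cells, bounded uniformly at each level, with at
    least [N n] points in every cell of level [n] ([nested_partitions]).  The set
    [bohr n] is chosen after the partitions, sparse enough to put at most one
    point of [E n] in each cell of level [n].  Since coarser cells are unions of
    finer ones, a cell [C] of level [n] contains at most [#|C| / N i] points of
    [E i] for each [i <= n].  With the sum of all [1 / N i] at most [1 - c], a
    proportion [c] of [C] is left, so there is a set of [c * #|C|] points of [C],
    up to rounding, avoiding [E 0], ..., [E n] ([select]).  Gluing such choices
    over cells whose level tends to infinity, so that the cells of level below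
    [n] cover a finite set only, gives an [A] that meets each [E n] in a finite
    set ([balanced_set]).

    The density is [c] along [Phi] because the rounding error in a cell is at
    most 1, hence negligible in large cells, and because a Folner set is almost
    exactly a union of cells, provided that the levels grow slowly enough with
    respect to [Phi] ([folner_rank], [level_exists], [balanced_density]). *)

Set Implicit Arguments.
Unset Strict Implicit.
Unset Printing Implicit Defensive.

Import Order.TTheory GRing.Theory Num.Theory.
Import numFieldNormedType.Exports.

Local Open Scope classical_set_scope.
Local Open Scope ring_scope.

(** * Rotations of the circle preserve Lebesgue measure *)

Section circle.
Variable R : realType.
Local Notation leb := (@lebesgue_measure R).
Local Notation RT := (measurableTypeR R).

Lemma measurable_translate (a : R) : measurable_fun [set: RT] (fun x : RT => x + a : RT).
Proof.
by apply: measurable_realfun.measurable_funD;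
  [exact: measurable_id|exact: measurable_cst].
Qed.

(** The pushforward by a translation agrees with Lebesgue measure on
    half-open intervals, hence everywhere. *)
Lemma lebesgue_measure_translate (a : R) (A : set RT) : measurable A ->
  leb ((fun x : RT => x + a : RT) @^-1` A) = leb A.
Proof.
move=> mA; pose T : RT -> RT := fun x => x + a.
have mT : measurable_fun setT T := measurable_translate a.
apply/esym; rewrite -[RHS]/(pushforward leb T A).
apply: (@lebesgue_measure_unique R (pushforward leb T)) => // X.
rewrite /ocitv => -[[u v] /= _ <-].
have -> : pushforward leb T `]u, v] = leb `]u - a, v - a]%classic.
  congr (leb _); apply/seteqP; split => x /=; rewrite /T !in_itv /=; lra.
rewrite !lebesgue_measure_itv /= !lte_fin ltrD2r.
by case: ifP => // _; rewrite -!EFinB; congr (_%:E); ring.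
Qed.

Definition unit_itv : set RT := `[0, 1[%classic.

Lemma measurable_unit_itv : measurable unit_itv.
Proof. exact: measurable_itv. Qed.

Definition circle_measure : set RT -> \bar R := mrestr leb measurable_unit_itv.

HB.instance Definition _ := Measure.on circle_measure.

Lemma circle_measure_setT : circle_measure setT = 1%E.
Proof.
by rewrite /circle_measure /mrestr setTI /unit_itv lebesgue_measure_itv /= lte_fin ltr01
  oppr0 adde0.
Qed.

HB.instance Definition _ := @Measure_isProbability.Build _ _ R
  circle_measure circle_measure_setT.

(** The circle is modelled by the whole real line, with the measure carried by
    the fundamental domain [0 <= x < 1]; the rotation fixes every point outside
    this domain, which keeps the action laws true at all points. *)
Definition circle_rot (t : R) (x : RT) : RT :=
  if (0 <= x) && (x < 1) then (if x + t < 1 then x + t else x + (t - 1)) else x.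

Lemma circle_rot_preimage (t : R) (Y : set RT) : 0 <= t < 1 ->
  circle_rot t @^-1` Y =
    (`[0, (1 - t)[%classic `&` (fun x : RT => x + t : RT) @^-1` Y) `|`
    ((`[(1 - t), 1[%classic `&` (fun x : RT => x + (t - 1) : RT) @^-1` Y) `|`
     (~` unit_itv `&` Y)).
Proof.
move=> t01; apply/seteqP; split => x /=; rewrite /circle_rot /unit_itv /= !in_itv /=.
  case: ifP => [x01|x01].
    case: ltP => xt Yx; [left|right; left]; split => //; move: x01 xt; lra.
  by move=> Yx; right; right; split => //; rewrite x01.
case=> [[x0 Yx]|[[x0 Yx]|[x0 Yx]]].
- rewrite ifT; last by move: x0; lra.
  by rewrite ifT //; move: x0; lra.
- rewrite ifT; last by move: x0; lra.
  by rewrite ifF //; move: x0; lra.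
- by rewrite ifF //; apply/negP.
Qed.

Lemma measurable_circle_rot (t : R) : 0 <= t < 1 -> measurable_fun setT (circle_rot t).
Proof.
move=> t01 _ Y mY; rewrite setTI circle_rot_preimage //.
have pre a : measurable ((fun x : RT => x + a : RT) @^-1` Y).
  by rewrite -[X in measurable X]setTI; exact: measurable_translate.
apply: measurableU; first by apply: measurableI => //; exact: measurable_itv.
apply: measurableU; first by apply: measurableI => //; exact: measurable_itv.
by apply: measurableI => //; apply: measurableC; exact: measurable_unit_itv.
Qed.

(** On the fundamental domain a rotation by [t] translates the points
    [x < 1 - t] by [t] and the others by [t - 1]. *)
Lemma circle_measure_circle_rot (t : R) (Y : set RT) : 0 <= t < 1 -> measurable Y ->
  circle_measure (circle_rot t @^-1` Y) = circle_measure Y.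
Proof.
move=> t01 mY; rewrite /circle_measure /mrestr.
have mI (a b : R) : measurable (`[a, b[%classic : set RT) by exact: measurable_itv.
pose Y1 : set RT := `[t, 1[%classic `&` Y.
pose Y2 : set RT := `[0, t[%classic `&` Y.
have mY1 : measurable Y1 by exact: measurableI.
have mY2 : measurable Y2 by exact: measurableI.
have pre a (Z : set RT) : measurable Z -> measurable ((fun x : RT => x + a : RT) @^-1` Z).
  by move=> mZ; rewrite -[X in measurable X]setTI; exact: measurable_translate.
have -> : circle_rot t @^-1` Y `&` unit_itv =
    (fun x : RT => x + t : RT) @^-1` Y1 `|` (fun x : RT => x + (t - 1) : RT) @^-1` Y2.
  rewrite circle_rot_preimage // /unit_itv; apply/seteqP; split => x;
    rewrite /= /Y1 /Y2 /= !in_itv /=.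
    case=> -[[h Yx]|[[h Yx]|[h Yx]]] h'; last by case: h.
    - by left; split => //; move: h h'; lra.
    - by right; split => //; move: h h'; lra.
  case=> -[h Yx]; split; [left| |right; left |]; try (split => //); move: h; lra.
have -> : Y `&` unit_itv = Y1 `|` Y2.
  rewrite /unit_itv; apply/seteqP; split => x; rewrite /= /Y1 /Y2 /= !in_itv /=.
    by case=> Yx h; case: (leP t x) => tx; [left|right]; split => //; move: h tx; lra.
  by case=> -[h Yx]; split => //; move: h; lra.
rewrite !measureU //; try exact: pre.
- by congr (_ + _)%E; exact: lebesgue_measure_translate.
- rewrite -subset0 => x; rewrite /= /Y1 /Y2 /= !in_itv /= => -[[h _] [h' _]].
  by move: h h'; lra.
- rewrite -subset0 => x; rewrite /= /Y1 /Y2 /= !in_itv /= => -[[h _] [h' _]].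
  by move: h h'; lra.
Qed.

End circle.

(** * Avoidable sets of group elements *)

(** Avoidance is required to hold with no exception in [Y], and not only up to
    a null set; this is harmless for the existence of a system and spares almost
    everywhere arguments in products. *)
Definition avoidable (R : realType) (G : zmodType) (A : set G) : Prop :=
  exists (d : measure_display) (X : measurableType d) (mu : probability X R)
    (act : G -> X -> X) (Y : set X),
  [/\ mp_action mu act, measurable Y, (0 < mu Y)%E &
   forall g y, A g -> g != 0 -> Y y -> ~ Y (act g y)].

Lemma avoidable_not_recurrence (R : realType) (G : zmodType) (A : set G) :
  avoidable R A -> ~ recurrence_set R A.
Proof.
case=> d [X [mu [act [Y [actP mY muY AY]]]]] recA.
have [g [Ag g0 +]] := recA _ _ _ _ actP _ mY muY.
rewrite (_ : Y `&` act g @` Y = set0) ?measure0 ?ltxx //.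
rewrite -subset0 => x [/= Yx [y Yy eqx]]; apply: (AY _ _ Ag g0 Yy).
by rewrite eqx.
Qed.

Lemma avoidableS (R : realType) (G : zmodType) (A B : set G) :
  A `<=` B -> avoidable R B -> avoidable R A.
Proof.
move=> AB [d [X [mu [act [Y [actP mY muY BY]]]]]].
by exists d, X, mu, act, Y; split=> // g y /AB; exact: BY.
Qed.

Section product_system.
Variables (R : realType) (G : zmodType).
Variables (d1 d2 : measure_display) (X1 : measurableType d1) (X2 : measurableType d2).
Variables (mu1 : probability X1 R) (mu2 : probability X2 R).

Definition prod_measure : set (X1 * X2) -> \bar R := (mu1 \x mu2)%E.

HB.instance Definition _ := Measure.on prod_measure.

Lemma prod_measure_setT : prod_measure setT = 1%E.
Proof.
rewrite /prod_measure -setXTT; transitivity (mu1 setT * mu2 setT)%E.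
  exact: product_measure1E.
by rewrite !probability_setT mule1.
Qed.

HB.instance Definition _ := @Measure_isProbability.Build _ _ R
  prod_measure prod_measure_setT.

Variables (act1 : G -> X1 -> X1) (act2 : G -> X2 -> X2).
Hypotheses (act1P : mp_action mu1 act1) (act2P : mp_action mu2 act2).

Definition prod_act (g : G) (x : X1 * X2) := (act1 g x.1, act2 g x.2).

Lemma prod_act_measurable g : measurable_fun setT (prod_act g).
Proof.
apply/measurable_fun_pairP; split.
  apply: (measurableT_comp (mp_act_measurable act1P g)); exact: measurable_fst.
apply: (measurableT_comp (mp_act_measurable act2P g)); exact: measurable_snd.
Qed.

(** The pushforward of the product measure by the product action takes the
    right values on rectangles, which characterises the product measure. *)
Lemma prod_mp_action : mp_action (prod_measure : probability _ R) prod_act.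
Proof.
split=> [[x y]|g h [x y]|g|g Y mY].
- by rewrite /prod_act /= (mp_act0 act1P) (mp_act0 act2P).
- by rewrite /prod_act /= (mp_actD act1P) (mp_actD act2P).
- exact: prod_act_measurable.
- have mg := prod_act_measurable g.
  apply/esym.
  apply: (product_measure_unique (m' := pushforward prod_measure (prod_act g))) => //.
  move=> A B mA mB.
  rewrite -[LHS]/((mu1 \x mu2)%E ((act1 g @^-1` A) `*` (act2 g @^-1` B))).
  rewrite product_measure1E.
  + by congr (_ * _)%E;
      [exact: (mp_act_preserving act1P)|exact: (mp_act_preserving act2P)].
  + by rewrite -[X in measurable X]setTI; exact: (mp_act_measurable act1P).
  + by rewrite -[X in measurable X]setTI; exact: (mp_act_measurable act2P).
Qed.

End product_system.

(** In the product system a return to [Y1 `*` Y2] is a return to both factors. *)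
Lemma avoidableU (R : realType) (G : zmodType) (A B : set G) :
  avoidable R A -> avoidable R B -> avoidable R (A `|` B).
Proof.
case=> d1 [X1 [mu1 [act1 [Y1 [act1P mY1 muY1 AY]]]]].
case=> d2 [X2 [mu2 [act2 [Y2 [act2P mY2 muY2 BY]]]]].
exists _, (X1 * X2)%type, (prod_measure mu1 mu2 : probability _ R),
  (prod_act act1 act2), (Y1 `*` Y2).
split.
- exact: prod_mp_action.
- exact: measurableX.
- have E : prod_measure mu1 mu2 (Y1 `*` Y2) = (mu1 Y1 * mu2 Y2)%E.
    exact: product_measure1E.
  by move: (mule_gt0 muY1 muY2); rewrite -E.
- move=> g [y1 y2] /= ABg g0 [/= Yy1 Yy2] [/= Yg1 Yg2].
  by case: ABg => [Ag|Bg]; [apply: (AY g y1)|apply: (BY g y2)].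
Qed.

(** A homomorphism from [G] to R/Z, given by a real lift of each value. *)
Definition character (R : realType) (G : zmodType) (chi : G -> R) : Prop :=
  forall g h, exists k : int, chi (g + h) = chi g + chi h + k%:~R.

Section rotation.
Variables (R : realType) (G : zmodType) (chi : G -> R).
Hypothesis chiP : character chi.

Definition frac (x : R) : R := x - (Num.floor x)%:~R.

Lemma frac_itv x : 0 <= frac x < 1.
Proof.
rewrite /frac; have := floor_le x; have := floorD1_gt x.
by rewrite intrD; lra.
Qed.

Lemma eq_unit_itv (x y : R) (k : int) :
  0 <= x < 1 -> 0 <= y < 1 -> x = y + k%:~R -> x = y.
Proof.
move=> x01 y01 xyk.
have : (k%:~R : R) < 1%:~R by lra.
have : (-1)%:~R < (k%:~R : R) by lra.
rewrite !ltr_int => k1 k2.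
by rewrite xyk (_ : k = 0) ?addr0 //; lia.
Qed.

Lemma circle_rotE (t x : R) : 0 <= t < 1 -> 0 <= x < 1 -> 
  0 <= circle_rot t x < 1 /\ exists k : int, circle_rot t x = x + t + k%:~R :> R.
Proof.
move=> t01 x01; rewrite /circle_rot x01; case: ifP => xt.
  by split; [move: t01 x01 xt; lra|exists 0; rewrite addr0].
split; first by move: t01 x01 xt; lra.
by exists (-1); ring.
Qed.

Definition rotation (g : G) (x : measurableTypeR R) : measurableTypeR R :=
  circle_rot (frac (chi g)) x.

Lemma rotation_itv g (x : R) : 0 <= x < 1 -> 
  0 <= rotation g x < 1 /\ exists k : int, rotation g x = x + chi g + k%:~R :> R.
Proof.
move=> x01; rewrite /rotation.
have [r01 [k rk]] := circle_rotE (frac_itv (chi g)) x01; split=> //.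
rewrite rk; by exists (k - Num.floor (chi g)); rewrite /frac intrB; ring.
Qed.

Lemma rotation_out g (x : R) : (0 <= x < 1) = false -> rotation g x = x.
Proof. by rewrite /rotation /circle_rot => ->. Qed.

Lemma rotation_mp_action : mp_action (@circle_measure R : probability _ R) rotation.
Proof.
split.
- move=> x; have [x01|] := boolP (0 <= x < 1); last by move/negbTE/rotation_out.
  have [r01 [k xk]] := rotation_itv 0 x01.
  have [j] := chiP 0 0; rewrite addr0 => j0.
  apply: (eq_unit_itv (k := k - j)) => //; rewrite xk intrB; move: j0; lra.
- move=> g h x; have [x01|] := boolP (0 <= x < 1); last first.
    by move/negbTE => x01; rewrite !(rotation_out _ x01).
  have [r01 [k xk]] := rotation_itv (g + h) x01.
  have [r01' [k' xk']] := rotation_itv h x01.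
  have [r01'' [k'' xk'']] := rotation_itv g r01'.
  have [j j0] := chiP g h.
  apply: (eq_unit_itv (k := k - k' - k'' + j)) => //.
  rewrite xk xk'' xk' !(intrB, intrD); move: j0; lra.
- by move=> g; exact: (measurable_circle_rot (frac_itv (chi g))).
- by move=> g Y mY; exact: (circle_measure_circle_rot (frac_itv _)).
Qed.

(** Two points of the arc [0 <= y < delta] differ by less than [delta], whereas a
    rotation by [chi g] moves a point by [chi g] up to an integer. *)
Lemma avoidable_character (delta : R) : 0 < delta <= 1 ->
  avoidable R [set g | forall k : int, delta <= `|chi g - k%:~R|].
Proof.
move=> /andP[d0 d1].
exists _, _, (@circle_measure R : probability _ R), rotation, `[0, delta[%classic.
split.
- exact: rotation_mp_action.
- exact: measurable_itv.
- rewrite /= /circle_measure /mrestr (_ : _ `&` _ = `[0, delta[%classic).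
    by rewrite lebesgue_measure_itv /= lte_fin d0 oppr0 adde0 lte_fin.
  apply/seteqP; split => x; rewrite /unit_itv /= !in_itv /=; first by case.
  by move=> x0; split=> //; lra.
- move=> g y /= gd _; rewrite !in_itv /= => y0 gy.
  have y01 : 0 <= y < 1 by lra.
  have [_ [k gyk]] := rotation_itv g y01.
  have := gd (- k); rewrite intrN => gdk.
  have : `|chi g - - k%:~R| < delta.
    rewrite (_ : chi g - - k%:~R = rotation g y - y); last by rewrite gyk; ring.
    by rewrite ltr_norml; lra.
  lra.
Qed.

End rotation.

(** * Characters and Bohr neighbourhoods *)

Section characters.
Variables (R : realType) (G : zmodType).
Implicit Types (g h : G) (r s : R) (k : int).

(** The graph of a homomorphism to R/Z defined on a subgroup of [G], lifted to
    [G * R]: a subgroup of [G * R] that meets the fibre over 0 exactly in the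
    integers.  Working with graphs turns extensions of homomorphisms into
    inclusions of sets, to which Zorn's lemma applies directly. *)
Record partial_character (Gamma : set (G * R)) : Prop := PartialCharacter {
  pchar_int : forall k, Gamma (0, k%:~R) ;
  pcharB : forall x y, Gamma x -> Gamma y -> Gamma (x - y) ;
  pchar0 : forall r, Gamma (0, r) -> exists k, r = k%:~R }.

Section extension.
Variable Gamma : set (G * R).
Hypothesis GammaP : partial_character Gamma.

Lemma pchar00 : Gamma 0.
Proof. exact: (pchar_int GammaP 0). Qed.

Lemma pcharN x : Gamma x -> Gamma (- x).
Proof. by rewrite -sub0r => Gx; apply: (pcharB GammaP) => //; exact: pchar00. Qed.

Lemma pcharD x y : Gamma x -> Gamma y -> Gamma (x + y).
Proof. by move=> Gx /pcharN Gy; rewrite -[y]opprK; exact: (pcharB GammaP). Qed.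

Lemma pcharMz x k : Gamma x -> Gamma (x *~ k).
Proof.
move=> Gx; have Gn n : Gamma (x *+ n).
  by elim: n => [|n IHn]; [rewrite mulr0n; exact: pchar00|rewrite mulrS; exact: pcharD].
by case: k => n; [rewrite -pmulrn|rewrite NegzE mulrNz -pmulrn; apply: pcharN].
Qed.

Lemma pairMz g r k : (g, r) *~ k = (g *~ k, r *~ k).
Proof.
have E n : (g, r) *+ n = (g *+ n, r *+ n).
  by elim: n => [|n IHn]; rewrite ?mulr0n // !mulrS IHn.
by case: k => n; rewrite ?NegzE ?mulrNz -?pmulrn ?E.
Qed.

(** The subgroup generated by [Gamma] and [(g, r)]. *)
Definition adjoin g r : set (G * R) := [set z | exists k, Gamma (z - (g, r) *~ k)].

Lemma sub_adjoin g r : Gamma `<=` adjoin g r.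
Proof. by move=> z Gz; exists 0; rewrite mulr0z subr0. Qed.

Lemma adjoin_mem g r : adjoin g r (g, r).
Proof. by exists 1; rewrite mulr1z subrr; exact: pchar00. Qed.

Lemma partial_character_adjoin g r :
  (forall k s, Gamma (g *~ k, s) -> exists j : int, r *~ k - s = j%:~R) ->
  partial_character (adjoin g r).
Proof.
move=> rP; split.
- by move=> k; apply: sub_adjoin; exact: pchar_int.
- move=> x y [k xk] [l yl]; exists (k - l).
  have -> : x - y - (g, r) *~ (k - l) = x - (g, r) *~ k - (y - (g, r) *~ l).
    by rewrite mulrzBr !opprB addrACA [RHS]addrACA [- y - _]addrC.
  exact: (pcharB GammaP).
- move=> s [k]; rewrite pairMz => Gs.
  have /pcharN := Gs; rewrite opprB /= => /= G'.
  have [j rj] : exists j : int, r *~ k - (r *~ k - s) = j%:~R.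
    by apply: rP; rewrite -[g *~ k]subr0.
  by exists j; rewrite -rj; ring.
Qed.

(** Divisibility of R/Z: let [m] be the least positive integer with [g *+ m] in
    the domain, where the value is [s0].  Any solution [r] of [r * m = s0] modulo
    1 is an admissible value at [g]; if there is no such [m], every [r] is.  As
    [m > 1], two admissible values differ by [1 / m], so one of them is not an
    integer: this freedom makes the extension separate [g] from 0. *)
Lemma partial_character_extend g : (forall s, ~ Gamma (g, s)) ->
  exists r, (forall k, r != k%:~R) /\ partial_character (adjoin g r).
Proof.
move=> gNdom.
(* At least one of the [m]-th parts [x / m] and [(x + 1) / m] is not an integer. *)
have half (x : R) (m : nat) : (1 < m)%N ->
    exists2 r, (r = x / m%:R \/ r = (x + 1) / m%:R) & forall k, r != k%:~R.
  move=> m1; have m0 : (m%:R : R) != 0 by rewrite pnatr_eq0; lia.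
  have [[k xk]|/forallNP xN] := pselect (exists k, x / m%:R = k%:~R); last first.
    by exists (x / m%:R); [left|move=> k; apply/eqP/xN].
  exists ((x + 1) / m%:R); first by right.
  move=> j; apply/negP => /eqP; rewrite mulrDl xk mul1r => mj.
  have : (m%:R : R)^-1 = (j - k)%:~R by rewrite intrB -mj; ring.
  move=> mV; have : (1%:~R : R) == (m%:Z * (j - k))%:~R.
    by rewrite intrM -mV -pmulrn mulfV.
  rewrite eqr_int => /eqP mjk; have : (m %| 1)%Z by apply/dvdzP; exists (j - k); rewrite mulrC.
  by rewrite dvdz1; lia.
have [gper|/forallNP gfree] :=
  pselect (exists m, (0 < m)%N && `[< exists s, Gamma (g *+ m, s) >]).
  have [m /andP[m0 /asboolP[s0 Gs0]] mmin] := ex_minnP gper.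
  have m1 : (1 < m)%N.
    case: m m0 Gs0 {mmin} => [|[|m]] // _; rewrite mulr1n => /gNdom //.
  have [r rs rN] := half s0 m m1.
  have {rs}[s1 Gs1 rs1] : exists2 s1, Gamma (g *+ m, s1) & r = s1 / m%:R.
    case: rs => ->; first by exists s0.
    exists (s0 + 1) => //; rewrite -[g *+ m]addr0.
    exact: (pcharD Gs0 (pchar_int GammaP 1)).
  exists r; split=> //; apply: partial_character_adjoin => k s Gs.
  have m0R : (m%:R : R) != 0 by rewrite pnatr_eq0; lia.
  (* By minimality of [m], the multiples of [g] in the domain are those of
     [g *+ m]: the remainder [l] of [k] modulo [m] vanishes. *)
  have kE := divz_eq k m.
  pose q := (k %/ m)%Z; pose l := `|(k %% m)%Z|%N.
  have lE : (k %% m)%Z = l by rewrite /l gez0_abs // modz_ge0; lia.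
  have lm : (l < m)%N by rewrite -ltz_nat -lE ltz_pmod.
  have Gl : Gamma (g *+ l, s - s1 *~ q).
    have := pcharB GammaP Gs (pcharMz q Gs1).
    rewrite pairMz; congr (Gamma (_, _)).
    rewrite kE mulrzDr lE -pmulrn -/q [q * _]mulrC mulrzA -pmulrn.
    by rewrite addrAC subrr add0r.
  have l0 : l = 0%N.
    apply/eqP; rewrite -leqn0 leqNgt; apply/negP => l0.
    suff : (m <= l)%N by lia.
    by apply: mmin; rewrite l0; apply/asboolP; exists (s - s1 *~ q).
  rewrite l0 mulr0n in Gl; have [j sj] := pchar0 GammaP Gl.
  exists (- j); rewrite intrN -sj kE lE l0 addr0 -/q -mulrzr intrM -pmulrn rs1 -mulrzr.
  by field.
have [r _ rN] := half 0 2 isT.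
exists r; split=> //; apply: partial_character_adjoin => k s Gs.
have k0 : k = 0.
  have gk (n : nat) t : (0 < n)%N -> ~ Gamma (g *+ n, t).
    by move=> n0 Gn; apply: (gfree n); rewrite n0; apply/asboolP; exists t.
  case: k Gs => -[|n] //; first by rewrite -pmulrn => /(gk n.+1 s isT).
    by rewrite NegzE mulrNz => /pcharN; rewrite -[- _]/(- - _, - _) opprK -pmulrn;
      move/(gk 1%N _ isT).
  by rewrite NegzE mulrNz => /pcharN; rewrite -[- _]/(- - _, - _) opprK -pmulrn;
    move/(gk n.+2 _ isT).
move: Gs; rewrite k0 mulr0z => /(pchar0 GammaP)[j ->].
by exists (- j); rewrite mulr0z intrN; ring.
Qed.

End extension.

(** A maximal graph containing [Gamma] is total, since it could be extended at
    any missing point. *)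
Lemma partial_character_total (Gamma : set (G * R)) :
  partial_character Gamma ->
  exists2 chi : G -> R, character chi &
    forall g r, Gamma (g, r) -> exists k, chi g = r + k%:~R.
Proof.
move=> GammaP.
(* The empty set is added only because it is the union of the empty chain. *)
pose P D := D = set0 \/ partial_character D /\ Gamma `<=` D.
have [F FP Ftot|D [DP Dmax]] := @Zorn_bigcup _ P.
  have [->|/set0P[x0 [X0 FX0 X0x0]]] := eqVneq (\bigcup_(X in F) X) set0; first by left.
  right.
  have FPX X x : F X -> X x -> partial_character X /\ Gamma `<=` X.
    by move=> FX Xx; case: (FP X FX) => // XE; move: Xx; rewrite XE.
  have [X0P GX0] := FPX X0 x0 FX0 X0x0.
  split; last by move=> x Gx; exists X0 => //; exact: GX0.
  split.
  - by move=> k; exists X0 => //; exact: pchar_int.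
  - move=> x y [X FX Xx] [Y FY Yy].
    have [XP _] := FPX X x FX Xx; have [YP _] := FPX Y y FY Yy.
    have [XY|YX] := Ftot X Y FX FY.
      by exists Y => //; apply: (pcharB YP) => //; exact: XY.
    by exists X => //; apply: (pcharB XP) => //; exact: YX.
  - by move=> r [X FX Xr]; have [XP _] := FPX X _ FX Xr; exact: (pchar0 XP Xr).
have {DP}[DP GD] : partial_character D /\ Gamma `<=` D.
  case: DP => // D0; exfalso; apply: (Dmax Gamma); last by right; split.
  rewrite D0; split; first by [].
  by move=> /(_ 0 (pchar00 GammaP)).
have /choice[chi chiD] : forall g, exists r, D (g, r).
  move=> g; apply: contrapT => /forallNP gN.
  have [r [_ rP]] := partial_character_extend DP gN.
  apply: (Dmax (adjoin D g r)).
    split; first exact: sub_adjoin.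
    by move=> /(_ (g, r) (adjoin_mem DP g r)); exact: gN.
  by right; split=> //; apply: (subset_trans GD); exact: sub_adjoin.
have chiE g r : D (g, r) -> exists k, chi g = r + k%:~R.
  move=> Dgr; have := pcharB DP (chiD g) Dgr.
  rewrite -[_ - _]/(g - g, chi g - r) subrr => /(pchar0 DP)[k ck].
  by exists k; rewrite -ck; ring.
exists chi; last by move=> g r /GD; exact: chiE.
move=> g h; apply: chiE.
exact: (pcharD DP (chiD g) (chiD h)).
Qed.

(** Extend the trivial character of the trivial subgroup to [h] with a value
    that is not an integer, then to all of [G]. *)
Lemma character_separates h : h != 0 ->
  exists2 chi : G -> R, character chi & forall k, chi h != k%:~R.
Proof.
move=> h0; pose Gamma0 : set (G * R) := [set z | z.1 = 0 /\ exists k, z.2 = k%:~R].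
have G0P : partial_character Gamma0.
  split=> [k|[x r] [y s] /= [/= -> [k ->]] [/= -> [l ->]]|r [_] //].
    by split=> //; exists k.
  by split; rewrite /= ?subr0 //; exists (k - l); rewrite intrB.
have [|r [rN GP]] := partial_character_extend G0P (g := h).
  by move=> s [/= h00]; rewrite h00 eqxx in h0.
have [chi chiP chiE] := partial_character_total GP.
exists chi => // k; have [j ->] := chiE _ _ (adjoin_mem G0P h r).
apply/negP => /eqP rj; have /negP := rN (k - j); apply; apply/eqP.
by rewrite intrB -rj; ring.
Qed.

End characters.

Lemma avoidable0 (R : realType) (G : zmodType) : avoidable R (set0 : set G).
Proof.
have chiP : character (fun _ : G => 0 : R) by move=> g h; exists 0; rewrite !addr0.
apply: (avoidableS _ (avoidable_character chiP (delta := 1) _)) => //.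
by rewrite ltr01 lexx.
Qed.

Lemma dist_int_gt0 (R : realType) (x : R) : (forall k : int, x != k%:~R) ->
  exists2 e : R, 0 < e <= 1 & forall k : int, e <= `|x - k%:~R|.
Proof.
move=> xN.
have f0 := floor_le x; have f1 := floorD1_gt x; set f := Num.floor x in f0 f1.
have {}f0 : f%:~R < x by rewrite lt_neqAle eq_sym xN.
rewrite intrD in f1.
have [e [e0 e1 e2]] : exists e, [/\ 0 < e, e <= x - f%:~R & e <= f%:~R + 1 - x].
  have [le|/ltW le] := lerP (x - f%:~R) (f%:~R + 1 - x).
    by exists (x - f%:~R); split => //; lra.
  by exists (f%:~R + 1 - x); split => //; lra.
exists e; first by lra.
move=> k; have [kf|fk] := lerP k f.
  have : (k%:~R : R) <= f%:~R by rewrite ler_int.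
  by move=> kfR; apply: le_trans (ler_norm _); lra.
have : (f%:~R + 1 : R) <= k%:~R by rewrite -(intrD _ f 1) ler_int; lia.
by move=> kfR; rewrite distrC; apply: le_trans (ler_norm _); lra.
Qed.

(** If [chi h] is at distance at least [e] from 0 in R/Z, then two points with
    [chi] within [e / 2] of 0 cannot differ by [h]. *)
Lemma bohr_separation1 (R : realType) (G : zmodType) (h : G) :
  exists B : set G, [/\ avoidable R (~` B), B 0 &
    forall x y, B x -> B y -> y - x = h -> x = y].
Proof.
have [h0|h0] := eqVneq h 0.
  exists setT; split=> //; first by rewrite setCT; exact: avoidable0.
  by move=> x y _ _; rewrite h0 => /subr0_eq ->.
have [chi chiP chih] := character_separates R h0.
have [e e01 eh] := dist_int_gt0 chih.
exists [set g | exists k : int, `|chi g - k%:~R| < e / 2]; split.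
- apply: (avoidableS _ (avoidable_character chiP (delta := e / 2) _)); last by lra.
  by move=> g /= gN k; rewrite leNgt; apply/negP => gk; apply: gN; exists k.
- have [j] := chiP 0 0; rewrite addr0 => j0.
  by exists (- j); rewrite intrN (_ : _ - _ = 0) ?normr0; lra.
- move=> x y [k xk] [l yl] yxh; exfalso.
  have [j] := chiP h x; rewrite -{1}yxh subrK => hj.
  have := eh (l - k - j); rewrite !intrB.
  rewrite (_ : chi h - _ = (chi y - l%:~R) - (chi x - k%:~R)); last by rewrite hj; ring.
  by have := ler_normB (chi y - l%:~R) (chi x - k%:~R); lra.
Qed.

(** The intersection of the neighbourhoods obtained for each element of [F]. *)
Lemma bohr_separation (R : realType) (G : zmodType) (F : {fset G}) :
  exists B : set G, [/\ avoidable R (~` B), B 0 &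
    forall x y, B x -> B y -> y - x \in F -> x = y].
Proof.
elim/finSet_rect: F => F IHF.
have [->|/fset0Pn[h hF]] := eqVneq F fset0.
  by exists setT; split=> //; rewrite setCT; exact: avoidable0.
have [B1 [B1a B10 B1P]] := IHF (F `\ h)%fset (fproperD1 hF).
have [B2 [B2a B20 B2P]] := bohr_separation1 R h.
exists (B1 `&` B2); split=> //; first by rewrite setCI; exact: avoidableU.
move=> x y [B1x B2x] [B1y B2y] yxF.
have [yxh|yxh] := eqVneq (y - x) h; first exact: B2P.
by apply: B1P => //; rewrite !inE yxh.
Qed.

(** As [0] belongs to the Bohr neighbourhood [B] that separates [F], no nonzero
    element of [F] lies in [B]. *)
Lemma avoidable_finite (R : realType) (G : zmodType) (F : {fset G}) :
  avoidable R [set` F].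
Proof.
have [B [Ba B0 BP]] := bohr_separation R F.
have [d [X [mu [act [Y [actP mY muY BY]]]]]] := Ba.
exists d, X, mu, act, Y; split=> // g y /= gF g0; apply: BY => //= Bg.
by move/eqP: g0; apply; apply/esym/(BP 0 g) => //; rewrite subr0.
Qed.

(** * Nested partitions into bounded cells *)

Section partitions.
Variable G : zmodType.
Implicit Types (D K : {fset G}) (p q : G -> G).

(** A partition of [G] is given by the map [p] that sends each point to the
    label of its cell, labels being themselves elements of [G]; a finite set that
    contains all displacements [p x - x] bounds the cells uniformly. *)
Definition displacement p D := forall x, p x - x \in D.

Definition fibres_ge p (N : nat) :=
  forall x, exists2 C : {fset G}, (N <= #|` C|)%N & forall y, y \in C -> p y = p x.

(** Take a maximal family [X] of centres whose translates of [K] are pairwise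
    disjoint.  By maximality every translate [y + K] meets some [x + K] with [x]
    in [X]; attach [y] to such an [x], and to the one with [y] in [x + K] if
    there is one.  The cell of [x] is contained in [x + K - K] and contains
    [x + K]. *)
Lemma voronoi K : 0 \in K ->
  exists q D, displacement q D /\ forall x k, k \in K -> q (q x + k) = q x.
Proof.
move=> K0.
pose P X := forall x y k l : G, X x -> X y -> k \in K -> l \in K ->
  x + k = y + l -> x = y.
have [F FP Ftot|X [XP Xmax]] := @Zorn_bigcup G P.
  move=> x y k l [X FX Xx] [Y FY Yy] kK lK.
  have [XY|YX] := Ftot X Y FX FY.
    by apply: (FP Y FY) kK lK => //; exact: XY.
  by apply: (FP X FX) kK lK => //; exact: YX.
have meet y : exists x, X x /\ exists k l, [/\ k \in K, l \in K & y + k = x + l].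
  apply: contrapT => /forallNP yN.
  have yfree x k l : X x -> k \in K -> l \in K -> y + k <> x + l.
    by move=> Xx kK lK eqy; apply: (yN x); split=> //; exists k, l.
  apply: (Xmax (X `|` [set y])).
    split; first by left.
    by move=> /(_ y (or_intror erefl)) Xy; exact: (yfree y 0 0).
  move=> x z k l [Xx|->] [Xz|->] kK lK // eqxz.
  - exact: XP kK lK eqxz.
  - by case: (yfree x l k).
  - by case: (yfree z k l).
have center y : exists x, [/\ X x, exists2 k, k \in K & exists2 l, l \in K & y + k = x + l
    & forall x', X x' -> (exists2 l, l \in K & y = x' + l) -> x = x'].
  have [[x [Xx [l lK yx]]]|yN] :=
      pselect (exists x, X x /\ exists2 l, l \in K & y = x + l).
    exists x; split=> //; first by exists 0 => //; exists l; rewrite ?addr0.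
    by move=> x' Xx' [l' l'K]; rewrite yx; exact: XP.
  have [x [Xx [k [l [kK lK eqy]]]]] := meet y.
  exists x; split=> //; first by exists k => //; exists l.
  by move=> x' Xx' yx'; case: yN; exists x'.
have [q qP] := choice center.
exists q, [fset k - l | k in K, l in K]%fset; split.
  move=> y; have [_ [k kK [l lK eqy]] _] := qP y.
  rewrite (_ : q y - y = k - l); first by apply/imfset2P; exists k => //; exists l.
  have -> : q y = y + (k - l) by rewrite addrA eqy addrK.
  by rewrite [LHS]addrC addKr.
move=> x k kK; have [Xqx _ _] := qP x.
have [_ _ qqx] := qP (q x + k).
by apply: qqx => //; exists k.
Qed.

Hypothesis Ginfinite : infinite_set [set: G].

(** The partition that merges cells of [p] according to the cells of their
    labels in a partition [q] whose cells contain translates of [K0 + D]: if [y]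
    lies in a translate [t + K0] then its label [p y] lies in [t + K0 + D], so
    the merged cell contains the whole of [t + K0]. *)
Lemma coarsen p D (N : nat) : displacement p D ->
  exists p' D', [/\ displacement p' D', fibres_ge p' N &
    forall x y, p x = p y -> p' x = p' y].
Proof.
move=> pD; have [K0 _ K0N] := infinite_set_fset N Ginfinite.
pose K := (0 |` [fset (k + d)%R | k in K0, d in D])%fset.
have [|q [E [qE qK]]] := @voronoi K; first by rewrite !inE eqxx.
exists (q \o p), [fset (e + d)%R | e in E, d in D]%fset; split.
- move=> x; apply/imfset2P; exists (q (p x) - p x); first exact: qE.
  by exists (p x - x); [exact: pD|rewrite subrKA].
- move=> x; exists [fset (q (p x) + k)%R | k in K0]%fset.
    by rewrite card_imfset //=; exact: addrI.
  move=> _ /imfsetP[k /= kK ->].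
  have -> : p (q (p x) + k) = q (p x) + (k + (p (q (p x) + k) - (q (p x) + k))).
    by rewrite addrA [RHS]addrC subrK.
  apply: qK; rewrite !inE; apply/orP; right; apply/imfset2P.
  by exists k => //; exists (p (q (p x) + k) - (q (p x) + k)).
- by move=> x y /= ->.
Qed.

Lemma nested_partitions (N : nat -> nat) :
  exists (p : nat -> G -> G) (B : nat -> {fset G}),
  [/\ forall n x y, p n x = p n y -> p n.+1 x = p n.+1 y,
      forall n x y, p n x = p n y -> y - x \in B n &
      forall n, fibres_ge (p n) (N n)].
Proof.
pose T := ((G -> G) * {fset G})%type.
have /choice[step stepP] : forall s : nat * T, exists t : T,
    displacement s.2.1 s.2.2 ->
    [/\ displacement t.1 t.2, fibres_ge t.1 (N s.1) &
      forall x y, s.2.1 x = s.2.1 y -> t.1 x = t.1 y].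
  move=> [n [p D]] /=; have [pD|] := pselect (displacement p D); last by exists (p, D).
  by have [p' [D' p'P]] := coarsen (N n) pD; exists (p', D').
pose seq := fix seq n : T :=
  step (n, if n is n'.+1 then seq n' else (idfun, [fset 0]%fset)).
have seqD n : displacement (seq n).1 (seq n).2.
  elim: n => [|n IHn]; last by have [] := stepP (n.+1, seq n) IHn.
  have [|//] := stepP (0%N, (idfun, [fset 0]%fset)).
  by move=> x; rewrite subrr inE.
exists (fun n => (seq n).1), (fun n => [fset (e - d)%R | e in (seq n).2, d in (seq n).2]%fset).
split=> n.
- by move=> x y; have [_ _] := stepP (n.+1, seq n) (seqD n); exact.
- move=> x y pxy; apply/imfset2P; exists ((seq n).1 x - x); first exact: seqD.
  exists ((seq n).1 y - y); first exact: seqD.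
  by rewrite pxy opprB [RHS]addrC subrKA.
- case: n => [|n]; last by have [] := stepP (n.+1, seq n) (seqD n).
  have [|//] := stepP (0%N, (idfun, [fset 0]%fset)).
  by move=> x; rewrite subrr inE.
Qed.

End partitions.

(** * Folner sequences and slowly growing levels *)

Lemma card_fset_sep (T : choiceType) (A : {fset T}) (P : pred T) :
  #|` [fset x in A | P x]%fset| = \sum_(x <- A | P x) 1.
Proof. by rewrite card_fset_sum1 big_fset. Qed.

Lemma leq_card_fset_sep (T : choiceType) (A : {fset T}) (P Q : pred T) :
  (forall x, x \in A -> P x -> Q x) ->
  (#|` [fset x in A | P x]%fset| <= #|` [fset x in A | Q x]%fset|)%N.
Proof.
move=> PQ; apply: fsubset_leq_card; apply/fsubsetP => x.
by rewrite !inE => /andP[xA Px]; rewrite xA PQ.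
Qed.

Section folner.
Variables (R : realType) (G : zmodType) (Phi : nat -> {fset G}).
Hypothesis PhiF : folner R Phi.

Lemma folner_card_gt0 m : (0 < #|` Phi m|)%N.
Proof. by rewrite cardfs_gt0; exact: PhiF.1. Qed.

(** The points of [F] that leave [F] under a translation by some element of [s];
    in a Folner sequence they become negligible. *)
Definition exits (F : {fset G}) (s : seq G) : {fset G} :=
  [fset x in F | has (fun b => (x + b)%R \notin F) s]%fset.

Lemma folner_exits (s : seq G) (e : R) : 0 < e ->
  \forall m \near \oo, #|` exits (Phi m) s|%:R <= e * #|` Phi m|%:R.
Proof.
elim: s e => [|b s IHs] e e0.
  apply: nearW => m; rewrite (_ : exits _ _ = fset0).
    by rewrite cardfs0 mulr_ge0 // ltW.
  by apply/fsetP => x; rewrite !inE andbF.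
have e20 : 0 < e / 2 by rewrite divr_gt0.
have /cvgrPdist_le /(_ _ e20) Fb := PhiF.2 (- b).
near=> m.
have m0 : 0 < (#|` Phi m|%:R : R) by rewrite ltr0n folner_card_gt0.
have Hb : #|` exits (Phi m) [:: b]|%:R <= (e / 2) * #|` Phi m|%:R.
  have : `|1 - #|` (Phi m `&` [fset (- b + x)%R | x in Phi m])%fset|%:R /
      #|` Phi m|%:R| <= e / 2.
    by near: m.
  have -> : (Phi m `&` [fset (- b + x)%R | x in Phi m])%fset =
      [fset x in Phi m | (x + b)%R \in Phi m]%fset.
    apply/fsetP => x; rewrite !inE; congr (_ && _).
    apply/imfsetP/idP => [[y /= yP ->]|xb]; first by rewrite addrAC addNr add0r.
    by exists (x + b) => //; rewrite addrC addrK.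
  have E : (#|` [fset x in Phi m | (x + b)%R \in Phi m]%fset| +
      #|` exits (Phi m) [:: b]| = #|` Phi m|)%N.
    rewrite [RHS]card_fset_sum1 !card_fset_sep [RHS](bigID (fun x => x + b \in Phi m)) /=.
    by congr (_ + _)%N; apply: eq_bigl => x; rewrite orbF.
  move=> H; rewrite -ler_pdivrMr //; apply: le_trans H; apply: le_trans (ler_norm _).
  rewrite le_eqVlt; apply/orP; left; apply/eqP; apply: (mulIf (lt0r_neq0 m0)).
  by rewrite mulrBl !divfK ?lt0r_neq0 // mul1r -E natrD addrC addKr.
have Hs : #|` exits (Phi m) s|%:R <= (e / 2) * #|` Phi m|%:R.
  by near: m; exact: IHs.
have : (#|` exits (Phi m) (b :: s)| <= #|` exits (Phi m) [:: b]| + #|` exits (Phi m) s|)%N.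
  rewrite -cardfsUI; apply: leq_trans (leq_addr _ _).
  apply: fsubset_leq_card; apply/fsubsetP => x; rewrite !inE /= orbF.
  by case/andP => -> /=.
rewrite -(ler_nat R) natrD => H.
by move: H Hb Hs; lra.
Unshelve. all: by end_near. Qed.

Hypothesis Ginfinite : infinite_set [set: G].

(** Since few points exit, some translate of a given finite set [K] is contained
    in [Phi m]. *)
Lemma folner_card (L : nat) : \forall m \near \oo, (L <= #|` Phi m|)%N.
Proof.
have [K _ KL] := infinite_set_fset L Ginfinite.
have half0 : 0 < (2^-1 : R) by rewrite invr_gt0.
near=> m; apply: (leq_trans KL).
have : #|` exits (Phi m) K|%:R <= (2^-1 : R) * #|` Phi m|%:R.
  by near: m; exact: folner_exits.
move=> H; have [x xP xK] : exists2 x, x \in Phi m & x \notin exits (Phi m) K.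
  apply/not_exists2P => /= allx.
  have : (Phi m `<=` exits (Phi m) K)%fset.
    by apply/fsubsetP => x xP; have := allx x => -[|/negP]; rewrite ?negbK.
  move=> /fsubset_leq_card; rewrite -(ler_nat R).
  have : 0 < (#|` Phi m|%:R : R) by rewrite ltr0n folner_card_gt0.
  lra.
have -> : #|` K| = #|` [fset (x + k)%R | k in K]%fset|.
  by rewrite card_imfset //=; exact: addrI.
apply: fsubset_leq_card; apply/fsubsetP => _ /imfsetP[k /= kK ->].
move: xK; rewrite !inE xP /= => /hasPn /(_ k kK).
by rewrite negbK.
Unshelve. all: by end_near. Qed.

Hypothesis Gcountable : countable [set: G].

(** The rank is a finite-to-one function growing so slowly that, for most [x] in
    [Phi m], the translates [x + B l] with [l <= rho x] stay in [Phi m].  Here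
    [kappa m] is the largest [k <= m] such that the proportion of points exiting
    under the translations of level at most [k] is below [1 / (k + 1)] from index
    [m] on.  It tends to infinity, and [rho] is at most [kappa m] on [Phi m];
    the injection [e0] of [G] in [nat] gives a rank to the points outside of
    every [Phi m]. *)
Lemma folner_rank (B : nat -> {fset G}) : exists rho : G -> nat,
  (forall n, finite_set [set x | (rho x <= n)%N]) /\
  forall e : R, 0 < e -> \forall m \near \oo,
    #|` [fset x in Phi m |
      `[< exists l b, [/\ (l <= rho x)%N, b \in B l & (x + b)%R \notin Phi m] >]]%fset|%:R
      <= e * #|` Phi m|%:R.
Proof.
have /countable_injP[e0 e0inj] := Gcountable.
pose BB k : seq G := flatten [seq (B l : seq G) | l <- iota 0 k.+1].
have /choice[M MP] : forall k : nat, exists M, forall m, (M <= m)%N ->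
    #|` exits (Phi m) (BB k)|%:R <= (k.+1%:R^-1 : R) * #|` Phi m|%:R.
  move=> k; have k0 : 0 < (k.+1%:R^-1 : R) by rewrite invr_gt0.
  by have [M _ MP] := folner_exits (BB k) k0; exists M => m; exact: MP.
pose kappa m := \max_(k < m.+1 | (M k <= m)%N) k.
have kappa_ge k m : (k <= m)%N -> (M k <= m)%N -> (k <= kappa m)%N.
  move=> km Mkm; rewrite -ltnS in km.
  exact: (@leq_bigmax_cond _ (fun i : 'I_m.+1 => (M i <= m)%N)
    (fun i => i : nat) (Ordinal km)).
have kappaM k m : (k <= m)%N -> (M k <= m)%N -> (M (kappa m) <= m)%N.
  move=> km Mkm; rewrite -ltnS in km.
  rewrite /kappa.
  have [|i Mi ->] := @eq_bigmax_cond _ (fun i : 'I_m.+1 => (M i <= m)%N) (fun i => i : nat).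
    by apply/card_gt0P; exists (Ordinal km).
  exact: Mi.
pose Q x k := (e0 x <= k)%N || `[< exists m, x \in Phi m /\ (kappa m <= k)%N >].
have Qex x : exists k, Q x k by exists (e0 x); rewrite /Q leqnn.
pose rho x := ex_minn (Qex x).
have rhoP x n : (rho x <= n)%N -> (e0 x <= n)%N \/ exists m, x \in Phi m /\ (kappa m <= n)%N.
  rewrite /rho; case: ex_minnP => k /orP[ek|/asboolP[m [xm km]]] _ kn.
    by left; exact: leq_trans kn.
  by right; exists m; split=> //; exact: leq_trans kn.
have rho_kappa x m : x \in Phi m -> (rho x <= kappa m)%N.
  move=> xm; rewrite /rho; case: ex_minnP => k _; apply.
  by rewrite /Q; apply/orP; right; apply/asboolP; exists m.
exists rho; split.
- move=> n.
  apply: (@sub_finite_set _ _ ([set x | (e0 x < n.+1)%N] `|`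
     \bigcup_(m in [set m | (m < maxn n.+1 (M n.+1))%N]) [set` Phi m])).
    move=> x /= /rhoP[ex|[m [xm km]]]; [by left|right; exists m => //=].
    rewrite ltnNge geq_max; apply/negP => /andP[nm Mm].
    by have := kappa_ge _ _ nm Mm; rewrite leqNgt ltnS km.
  rewrite finite_setU; split.
    apply: (@finite_preimage _ _ `I_n.+1 e0); last exact: finite_II.
    by move=> x y _ _; apply: e0inj; rewrite inE.
  apply: bigcup_finite; first exact: finite_II.
  by move=> m _; exact: finite_fset.
- move=> e e_gt0.
  pose K := (Num.truncn e^-1).+1.
  have Ke k : (K <= k)%N -> (k.+1%:R^-1 : R) <= e.
    move=> Kk; rewrite -[e]invrK lef_pV2 ?posrE ?invr_gt0 //.
    have := truncnS_gt e^-1; move=> /ltW /le_trans; apply.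
    by rewrite ler_nat; exact: leqW.
  exists (maxn K (M K)) => // m /=; rewrite geq_max => /andP[Km Mm].
  have kK := kappa_ge _ _ Km Mm; have Mk := kappaM _ _ Km Mm.
  apply: (@le_trans _ _ ((kappa m).+1%:R^-1 * #|` Phi m|%:R)); last first.
    by rewrite ler_wpM2r // Ke.
  apply: le_trans (MP (kappa m) m Mk).
  rewrite ler_nat; apply: leq_card_fset_sep => x xm /asboolP[l [b [lr bl xb]]].
  apply/hasP; exists b => //; apply/flattenP; exists (B l : seq G) => //.
  apply/mapP; exists l => //; rewrite mem_iota /= add0n ltnS.
  exact: leq_trans (rho_kappa x m xm).
Qed.

End folner.

Section level.
Variables (G : zmodType) (p : nat -> G -> G) (B : nat -> {fset G}).
Hypothesis nested : forall n x y, p n x = p n y -> p n.+1 x = p n.+1 y.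
Hypothesis bounded : forall n x y, p n x = p n y -> y - x \in B n.

Lemma nested_le i j x y : (i <= j)%N -> p i x = p i y -> p j x = p j y.
Proof.
by move=> /subnK <-; elim: (j - i)%N => // k IHk pxy; apply: nested; exact: IHk.
Qed.

(** The levels have to be constant on the cells they designate, which [rho]
    itself does not satisfy.  Let [V n] be the union of the cells of level
    [n + 1] that meet [rho <= n].  The sets [V n] are finite and increasing, and
    both [V n] and [V (n - 1)] are unions of cells of level [n]; the points of
    [V n] outside of [V (n - 1)] get level [n]. *)
Lemma level_exists (rho : G -> nat) :
  (forall n, finite_set [set x | (rho x <= n)%N]) ->
  exists lev : G -> nat,
  [/\ forall x, (lev x <= rho x)%N,
      forall n, finite_set [set x | (lev x <= n)%N] &
      forall x y, p (lev x) x = p (lev x) y -> lev y = lev x].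
Proof.
move=> rhofin.
pose V n x := `[< exists u, (rho u <= n)%N /\ p n.+1 x = p n.+1 u >].
have Vex x : exists n, V n x by exists (rho x); apply/asboolP; exists x.
have VS i j x : (i <= j)%N -> V i x -> V j x.
  move=> ij /asboolP[u [ui pxu]]; apply/asboolP; exists u; split.
    exact: leq_trans ij.
  exact: nested_le pxu.
have Vsat i j x y : (i <= j.+1)%N -> p i x = p i y -> V j x -> V j y.
  move=> ij pxy /asboolP[u [uj pxu]]; apply/asboolP; exists u; split=> //.
  by rewrite -pxu; apply/esym/(nested_le ij).
exists (fun x => ex_minn (Vex x)); split.
- by move=> x; case: ex_minnP => k _; apply; apply/asboolP; exists x.
- move=> n.
  apply: (@sub_finite_set _ _ (\bigcup_(u in [set u | (rho u <= n)%N])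
     [set` [fset (u + b)%R | b in B n.+1]%fset])).
    move=> x /=; case: ex_minnP => k Vk _ kn.
    have /asboolP[u [un pxu]] := VS _ _ _ kn Vk.
    exists u => //=; apply/imfsetP; exists (x - u) => /=; first exact: bounded.
    by rewrite addrC subrK.
  by apply: bigcup_finite => // u _; exact: finite_fset.
- move=> x y; case: ex_minnP => n Vn nmin pxy; case: ex_minnP => j Vj jmin.
  apply/eqP; rewrite eqn_leq jmin ?(Vsat n n x y) //= leqNgt; apply/negP => jn.
  case: n => [//|n] in Vn nmin pxy jn *.
  have : (n < n.+1 <= n)%N; last by rewrite ltnn andbF.
  rewrite ltnS leqnn /=; apply: nmin.
  by apply: (Vsat n.+1 n y x) => //; exact: VS Vj.
Qed.

End level.

(** * Choosing points in each cell *)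

Lemma in_fset_sep (T : choiceType) (A : {fset T}) (P : pred T) y :
  (y \in [fset x in A | P x]%fset) = (y \in A) && P y.
Proof. by rewrite !inE. Qed.

Lemma card_fset_sep_nat (T : choiceType) (A : {fset T}) (P : pred T) :
  #|` [fset x in A | P x]%fset| = (\sum_(x <- A) P x)%N.
Proof.
by rewrite card_fset_sep big_mkcond /=; apply: eq_bigr => x _; case: (P x).
Qed.

Lemma card_fset_le1 (T : choiceType) (A : {fset T}) :
  (forall x y, x \in A -> y \in A -> x = y) -> (#|` A| <= 1)%N.
Proof.
move=> A1; have [->|/fset0Pn[x xA]] := eqVneq A fset0; first by rewrite cardfs0.
rewrite -(cardfs1 x); apply: fsubset_leq_card; apply/fsubsetP => y yA.
by rewrite inE; apply/eqP; exact: A1.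
Qed.

Lemma fsubset_of_card (T : choiceType) (A : {fset T}) (k : nat) : (k <= #|` A|)%N ->
  exists2 S : {fset T}, (S `<=` A)%fset & #|` S| = k.
Proof.
move=> kA; exists [fset x in take k A]%fset.
  by apply/fsubsetP => x; rewrite inE => /mem_take.
by rewrite card_fseq undup_id ?take_uniq // size_takel.
Qed.

Section cells.
Variables (G : zmodType) (p : nat -> G -> G) (B : nat -> {fset G}) (N : nat -> nat).
Hypothesis nested : forall n x y, p n x = p n y -> p n.+1 x = p n.+1 y.
Hypothesis bounded : forall n x y, p n x = p n y -> y - x \in B n.
Hypothesis fat : forall n, fibres_ge (p n) (N n).

Definition cell n x : {fset G} :=
  [fset y in [fset (x + b)%R | b in B n] | p n y == p n x]%fset.

Lemma mem_cell n x y : (y \in cell n x) = (p n y == p n x).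
Proof.
rewrite !inE andb_idl // => /eqP pyx; apply/imfsetP; exists (y - x) => /=.
  exact: bounded.
by rewrite addrC subrK.
Qed.

Lemma cell_self n x : x \in cell n x.
Proof. by rewrite mem_cell. Qed.

Lemma eq_cell n x y : p n x = p n y -> cell n x = cell n y.
Proof. by move=> pxy; apply/fsetP => z; rewrite !mem_cell pxy. Qed.

Lemma card_cell_ge n x : (N n <= #|` cell n x|)%N.
Proof.
have [C CN CP] := fat n x; apply: (leq_trans CN).
by apply: fsubset_leq_card; apply/fsubsetP => y /CP pyx; rewrite mem_cell pyx.
Qed.

(** The cell is a disjoint union of cells of level [i], each of which has at
    least [N i] points and at most one point in [E]; the count is done by
    exchanging a double sum over pairs of points in the same cell of level [i]. *)
Lemma card_cell_sparse (E : set G) i n x : (i <= n)%N ->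
  (forall y z, E y -> E z -> z - y \in B i -> y = z) ->
  (N i * #|` [fset y in cell n x | y \in E]%fset| <= #|` cell n x|)%N.
Proof.
move=> le_in EP; set C := cell n x; set C' := [fset y in C | y \in E]%fset.
have sub y : y \in C' -> (cell i y `<=` C)%fset.
  rewrite in_fset_sep mem_cell => /andP[/eqP pyx _].
  apply/fsubsetP => z; rewrite !mem_cell => /eqP pzy.
  by rewrite -pyx (nested_le nested le_in pzy).
apply: (@leq_trans (\sum_(y <- C') #|` cell i y|)%N).
  rewrite card_fset_sum1 big_distrr /=; apply: leq_sum => y _.
  by rewrite muln1; exact: card_cell_ge.
rewrite (eq_big_seq (fun y => \sum_(z <- C) (p i z == p i y))%N); last first.
  move=> y yC'; rewrite -card_fset_sep_nat; congr #|` _|.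
  apply/fsetP => z; rewrite mem_cell [RHS]in_fset_sep andb_idl // => pzy.
  by apply: (fsubsetP (sub y yC')); rewrite mem_cell.
rewrite exchange_big /= [leqRHS]card_fset_sum1; apply: leq_sum => z _.
rewrite -card_fset_sep_nat; apply: card_fset_le1 => y1 y2.
rewrite !in_fset_sep => /andP[/andP[_ /set_mem E1] /eqP p1].
move=> /andP[/andP[_ /set_mem E2] /eqP p2].
by apply: EP => //; apply: bounded; rewrite -p1.
Qed.

Variables (R : realType) (c : R) (E : nat -> set G).
Hypotheses (c0 : 0 < c) (c1 : c < 1).
Hypothesis Ngt0 : forall n, (0 < N n)%N.
Hypothesis Nsum : forall n, \sum_(i < n.+1) (N i)%:R^-1 <= 1 - c.
Hypothesis sparse : forall i y z, E i y -> E i z -> z - y \in B i -> y = z.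

(** The points of the cell outside of [E 0], ..., [E n] make up a proportion at
    least [c], so the integer part of [c * #|C|] of them can be chosen. *)
Lemma select n x : exists S : {fset G},
  [/\ (S `<=` cell n x)%fset, forall i y, (i <= n)%N -> y \in S -> ~ E i y &
    `|#|` S|%:R - c * #|` cell n x|%:R| <= 1].
Proof.
set C := cell n x.
pose T := [fset y in C | ~~ [exists i : 'I_n.+1, y \in E i]]%fset.
have CT : (#|` C| <= #|` T| + \sum_(i < n.+1) #|` [fset y in C | y \in E i]%fset|)%N.
  under eq_bigr do rewrite card_fset_sep_nat.
  rewrite exchange_big /= [#|` T|]card_fset_sep_nat -big_split /= card_fset_sum1.
  apply: leq_sum => y _; case: existsP => [[i yE]|//].
  by rewrite (bigD1 i) //= yE.
have cT : c * #|` C|%:R <= #|` T|%:R.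
  have : (#|` C|%:R : R) <= #|` T|%:R + \sum_(i < n.+1) #|` [fset y in C | y \in E i]%fset|%:R.
    by rewrite -natr_sum -natrD ler_nat.
  have : \sum_(i < n.+1) (#|` [fset y in C | y \in E i]%fset|%:R : R) <= (1 - c) * #|` C|%:R.
    apply: (@le_trans _ _ ((\sum_(i < n.+1) (N i)%:R^-1) * #|` C|%:R)); last first.
      by rewrite ler_wpM2r.
    rewrite mulr_suml; apply: ler_sum => i _.
    rewrite ler_pdivlMl ?ltr0n // -natrM ler_nat.
    by apply: card_cell_sparse; [rewrite -ltnS|exact: sparse].
  lra.
have cC0 : 0 <= c * #|` C|%:R by rewrite mulr_ge0 // ltW.
have t1 : (Num.truncn (c * #|` C|%:R))%:R <= c * #|` C|%:R by rewrite truncn_le.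
have t2 := truncnS_gt (c * #|` C|%:R).
have [|S ST Sk] := @fsubset_of_card _ T (Num.truncn (c * #|` C|%:R)).
  by rewrite -(ler_nat R); apply: le_trans cT.
exists S; split.
- by apply: (fsubset_trans ST); apply/fsubsetP => y; rewrite in_fset_sep => /andP[].
- move=> i y le_in /(fsubsetP ST); rewrite in_fset_sep => /andP[_ /existsPn yN] Eiy.
  rewrite -ltnS in le_in.
  by have /negP := yN (Ordinal le_in); apply; exact: mem_set.
- by rewrite Sk ler_norml; move: t2; rewrite -natr1; lra.
Qed.

Variables (lev : G -> nat).
Hypothesis lev_const : forall x y, p (lev x) x = p (lev x) y -> lev y = lev x.
Hypothesis lev_fin : forall n, finite_set [set x | (lev x <= n)%N].

Local Notation lcell x := (cell (lev x) x).

Lemma lcell_eq x y : y \in lcell x -> lev y = lev x /\ lcell y = lcell x.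
Proof.
rewrite mem_cell => /eqP pyx; have lyx := lev_const (esym pyx); split=> //.
by rewrite lyx; exact: eq_cell.
Qed.

Lemma lcell_sym x y : (y \in lcell x) = (x \in lcell y).
Proof. by apply/idP/idP => /lcell_eq[_ ->]; exact: cell_self. Qed.

(** On a union of cells, [f] may be replaced by its average over each cell. *)
Lemma lcell_average (I : {fset G}) (f : G -> R) :
  (forall x, x \in I -> (lcell x `<=` I)%fset) ->
  \sum_(x <- I) f x = \sum_(x <- I) #|` lcell x|%:R^-1 * \sum_(y <- lcell x) f y.
Proof.
move=> Icl.
have -> : \sum_(x <- I) #|` lcell x|%:R^-1 * \sum_(y <- lcell x) f y =
    \sum_(x <- I) \sum_(y <- I) ((x \in lcell y)%:R * (#|` lcell y|%:R^-1 * f y)).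
  rewrite [LHS]big_seq [RHS]big_seq; apply: eq_bigr => x xI.
  rewrite mulr_sumr.
  have -> : lcell x = [fset y in I | y \in lcell x]%fset.
    apply/fsetP => y; rewrite [RHS]in_fset_sep andb_idl //.
    exact: (fsubsetP (Icl x xI)).
  rewrite big_fset /= big_mkcond; apply: eq_bigr => y _.
  rewrite lcell_sym; case: ifP => [xy|_]; last by rewrite mul0r.
  rewrite mul1r; congr (_%:R^-1 * _); congr #|` _|.
  have [_ <-] := lcell_eq xy.
  apply/fsetP => z; rewrite [LHS]in_fset_sep andb_idl //; exact: (fsubsetP (Icl x xI)).
rewrite exchange_big /= [LHS]big_seq [RHS]big_seq; apply: eq_bigr => y yI.
rewrite -mulr_suml -natr_sum -card_fset_sep_nat.
have -> : [fset x in I | x \in lcell y]%fset = lcell y.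
  by apply/fsetP => z; rewrite [LHS]in_fset_sep andb_idl //; exact: (fsubsetP (Icl y yI)).
rewrite mulrA mulfV ?mul1r // pnatr_eq0 -lt0n.
exact: leq_trans (Ngt0 _) (card_cell_ge _ _).
Qed.

(** Gluing the choices of [select] over all cells: a point of [E n] in [A] has a
    level below [n], and there are finitely many of these. *)
Lemma balanced_set : exists A : set G,
  (forall n, finite_set (A `&` E n)) /\
  forall x, `|\sum_(y <- lcell x) ((y \in A)%:R - c)| <= 1.
Proof.
have /choice[sel selP] : forall z : nat * {fset G}, exists S : {fset G},
    forall x, z.2 = cell z.1 x ->
  [/\ (S `<=` z.2)%fset, forall i y, (i <= z.1)%N -> y \in S -> ~ E i y &
    `|#|` S|%:R - c * #|` z.2|%:R| <= 1].
  move=> [n C] /=; have [[x Cx]|Cn] := pselect (exists x, C = cell n x).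
    by have [S SP] := select n x; exists S => _ _; rewrite Cx.
  by exists fset0 => x Cx; case: Cn; exists x.
exists [set x | x \in sel (lev x, lcell x)]; split.
  move=> n; apply: sub_finite_set (lev_fin n) => x [/= xS Ex].
  rewrite leqNgt; apply/negP => nx.
  have [_ /(_ n x (ltnW nx) xS)] := selP (lev x, lcell x) x erefl.
  exact.
move=> x; have [/= SC _ Sc] := selP (lev x, lcell x) x erefl.
rewrite big_split /= big_const_seq count_predT iter_addr_0 -mulr_natr mulNr.
have -> : \sum_(y <- lcell x) ((y \in [set x | x \in sel (lev x, lcell x)])%:R : R) =
    #|` sel (lev x, lcell x)|%:R.
  rewrite -natr_sum -card_fset_sep_nat; congr (_%:R); congr #|` _|.
  apply/fsetP => y; rewrite [LHS]in_fset_sep.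
  have [yx|yNx] := boolP (y \in lcell x).
    have [ly cy] := lcell_eq yx.
    apply/idP/idP => [/set_mem /=|yS]; first by rewrite cy ly.
    by apply/mem_set; rewrite /= cy ly.
  by apply/esym/negbTE/negP => /(fsubsetP SC); exact/negP.
done.
Qed.

Variable Phi : nat -> {fset G}.
Hypothesis PhiF : folner R Phi.
Hypothesis Ginfinite : infinite_set [set: G].
Hypothesis lev_exits : forall e : R, 0 < e -> \forall m \near \oo,
  #|` [fset x in Phi m | ~~ (cell (lev x) x `<=` Phi m)%fset]%fset|%:R <= e * #|` Phi m|%:R.
Hypothesis Nlim : forall e : R, 0 < e -> exists n, forall k, (n <= k)%N -> (N k)%:R^-1 <= e.

(** Let [f] be the indicator of [A] minus [c].  The points of [Phi m] whose cell
    is not contained in [Phi m] are negligible.  Over the union of the other cells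
    the average of [f] over a cell of level [k] is at most [1 / N k]: this is
    small except on finitely many points, and [#|Phi m|] tends to infinity. *)
Lemma balanced_density (A : set G) :
  (forall x, `|\sum_(y <- lcell x) ((y \in A)%:R - c)| <= 1) ->
  has_density Phi A c.
Proof.
move=> Abal; apply/cvgrPdist_le => e e_gt0.
have e3 : 0 < e / 3 by rewrite divr_gt0.
have [n nP] := Nlim e3.
have /finite_fsetP[F FP] := lev_fin n.
pose L := (Num.truncn ((e / 3)^-1 * #|` F|%:R)).+1.
near=> m.
have m0 : 0 < (#|` Phi m|%:R : R) by rewrite ltr0n (folner_card_gt0 PhiF).
pose f y : R := (y \in A)%:R - c.
have fE : density_in R A (Phi m) - c = (\sum_(y <- Phi m) f y) / #|` Phi m|%:R.
  rewrite /density_in card_fset_sep_nat natr_sum /f big_split /=.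
  rewrite big_const_seq count_predT iter_addr_0 mulNrn -[c *+ _]mulr_natr mulrBl.
  by rewrite mulfK // gt_eqF.
rewrite distrC fE normrM normfV (normr_nat _ #|` Phi m|) ler_pdivrMr //.
pose full x := (lcell x `<=` Phi m)%fset.
rewrite (bigID full) /=; apply: (le_trans (ler_normD _ _)).
have fle y : `|f y| <= 1.
  by rewrite /f; case: (y \in A); rewrite /= ler_norml; move: c0 c1; lra.
have Hbad : `|\sum_(y <- Phi m | ~~ full y) f y| <= e / 3 * #|` Phi m|%:R.
  apply: (@le_trans _ _ #|` [fset x in Phi m | ~~ full x]%fset|%:R).
    rewrite card_fset_sep natr_sum; apply: le_trans (ler_norm_sum _ _ _) _.
    by apply: ler_sum => y _; exact: fle.
  by rewrite /full; near: m; exact: lev_exits.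
have Hfull : `|\sum_(y <- Phi m | full y) f y| <= \sum_(y <- Phi m) (N (lev y))%:R^-1.
  pose I := [fset y in Phi m | full y]%fset.
  have -> : \sum_(y <- Phi m | full y) f y = \sum_(y <- I) f y by rewrite big_fset.
  rewrite lcell_average; last first.
    move=> x; rewrite in_fset_sep => /andP[_ fx]; apply/fsubsetP => y yx.
    have [_ cy] := lcell_eq yx.
    by rewrite in_fset_sep /full cy (fsubsetP fx).
  apply: le_trans (ler_norm_sum _ _ _) _; rewrite big_fset /= big_mkcond.
  apply: ler_sum => y _; case: ifP => _; last by rewrite invr_ge0.
  have N0 : 0 < ((N (lev y))%:R : R) by rewrite ltr0n.
  have CN : ((N (lev y))%:R : R) <= #|` lcell y|%:R by rewrite ler_nat card_cell_ge.
  have C0 : 0 < (#|` lcell y|%:R : R) by exact: lt_le_trans CN.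
  rewrite normrM normfV normr_nat -[leRHS]mulr1.
  by apply: ler_pM; rewrite ?invr_ge0 ?lef_pV2 ?posrE //; exact: Abal.
have HN : \sum_(y <- Phi m) ((N (lev y))%:R^-1 : R) <= #|` F|%:R + e / 3 * #|` Phi m|%:R.
  rewrite (bigID (fun y => (lev y <= n)%N)) /=; apply: lerD.
    apply: (@le_trans _ _ #|` [fset x in Phi m | (lev x <= n)%N]%fset|%:R).
      rewrite card_fset_sep natr_sum; apply: ler_sum => y _.
      by rewrite invf_le1 ?ler1n ?ltr0n.
    rewrite ler_nat; apply: fsubset_leq_card; apply/fsubsetP => x.
    rewrite in_fset_sep => /andP[_ xn].
    have : [set` F] x by rewrite -FP.
    by [].
  rewrite big_mkcond card_fset_sum1 natr_sum mulr_sumr.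
  apply: ler_sum => y _; rewrite mulr1; case: ifP; last by move=> _; exact: ltW.
  by rewrite -ltnNge => /ltnW; exact: nP.
have HF : #|` F|%:R <= e / 3 * #|` Phi m|%:R.
  rewrite -ler_pdivrMl //.
  have : (L <= #|` Phi m|)%N by near: m; exact: (folner_card PhiF Ginfinite).
  rewrite -(ler_nat R); apply: le_trans; apply/ltW; exact: truncnS_gt.
by move: Hbad Hfull HN HF; lra.
Unshelve. all: by end_near. Qed.

End cells.

(** * Straus sets of prescribed density *)

Lemma summable_sizes (R : realType) (e : R) : 0 < e ->
  exists N : nat -> nat, [/\ forall n, (0 < N n)%N,
    forall n, \sum_(i < n) ((N i)%:R^-1 : R) <= e &
    forall d : R, 0 < d -> exists n, forall k, (n <= k)%N -> (N k)%:R^-1 <= d].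
Proof.
have bound (d : R) : 0 < d -> (Num.truncn d^-1).+1%:R^-1 <= d.
  move=> d0; rewrite -[leRHS]invrK lef_pV2 ?posrE ?invr_gt0 //.
  exact/ltW/truncnS_gt.
move=> e0; pose M := (Num.truncn e^-1).+1; have Me := bound _ e0.
(* The inverses form a geometric series of sum at most [1 / M]. *)
exists (fun n => 2 ^ n.+1 * M)%N; split.
- by move=> n; rewrite muln_gt0 expn_gt0.
- move=> n; apply: (@le_trans _ _ (M%:R^-1)) => //.
  have -> : \sum_(i < n) ((2 ^ i.+1 * M)%N%:R^-1 : R) = (1 - 2^-1 ^+ n) * M%:R^-1.
    elim: n => [|n IHn]; first by rewrite big_ord0 expr0 subrr mul0r.
    rewrite big_ord_recr /= IHn natrM natrX invfM -exprVn exprS -mulrDl.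
    by congr (_ * _); field.
  by rewrite ler_piMl ?invr_ge0 // gerBl exprn_ge0 // invr_ge0.
- move=> d d0; exists (Num.truncn d^-1).+1 => k dk; apply: le_trans (bound _ d0).
  rewrite lef_pV2 ?posrE ?ltr0n ?muln_gt0 ?expn_gt0 // ler_nat.
  apply: (leq_trans dk); apply: (@leq_trans (2 ^ k.+1)%N); last by rewrite leq_pmulr.
  by do 2 apply: ltnW; rewrite ltn_expl.
Qed.

(** Apart from finitely many elements, the translate lies in the complement of
    [B]. *)
Lemma translates_avoidable (R : realType) (G : zmodType) (A E B : set G) (g : G) :
  avoidable R (~` B) -> (forall a, A a -> B (g + a) -> E a) -> finite_set (A `&` E) ->
  avoidable R [set g + a | a in A].
Proof.
move=> Ba AE /finite_fsetP[F FE].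
apply: (avoidableS _ (avoidableU Ba (avoidable_finite R [fset (g + x)%R | x in F]%fset))).
move=> _ [a Aa <-]; have [Bga|] := pselect (B (g + a)); last by left.
right; apply/imfsetP; exists a => //=.
have : (A `&` E) a by split=> //; exact: AE.
by rewrite FE.
Qed.

Theorem theorem38 (R : realType) (G : zmodType)
    (Gcountable : countable [set: G]) (Ginfinite : infinite_set [set: G])
    (c : R) (c0 : 0 < c) (c1 : c < 1)
    (Phi : nat -> {fset G}) (PhiF : folner R Phi) :
  exists A : set G, straus_set R A /\ has_density Phi A c.
Proof.
have [e einj] := countable_injP _ Gcountable.
pose g n : G := xget 0 [set x | e x = n].
have gsurj x : exists n, g n = x.
  exists (e x); rewrite /g; case: xgetP => [y _ exy|/(_ x) /(_ erefl) //].
  by apply: einj; rewrite ?inE.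
have /summable_sizes[N [N0 Nsum Nlim]] : 0 < 1 - c by rewrite subr_gt0.
have [p [B [nested bounded fat]]] := nested_partitions Ginfinite N.
have /choice[bohr bohrP] := fun n => bohr_separation R (B n).
pose E n : set G := [set x | bohr n (g n + x)].
have sparse i y z : E i y -> E i z -> z - y \in B i -> y = z.
  move=> Ey Ez zy; have [_ _ /(_ (g i + y) (g i + z) Ey Ez)] := bohrP i.
  by rewrite opprD addrACA subrr add0r => /(_ zy) /addrI.
have [rho [rho_fin rho_exits]] := folner_rank PhiF Gcountable B.
have [lev [lev_rho lev_fin lev_const]] := level_exists nested bounded rho_fin.
have [A [AE Abal]] := balanced_set nested bounded fat c0 N0 (fun n => Nsum n.+1) sparse
  lev_const lev_fin.
have Ac : has_density Phi A c.
  apply: (balanced_density bounded fat c0 c1 N0 lev_const lev_fin PhiF Ginfinite) => // d d0.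
  have := rho_exits d d0; apply: filterS => m; apply: le_trans.
  rewrite ler_nat; apply: leq_card_fset_sep => z _ /fsubsetPn[y].
  rewrite mem_cell // => /eqP pyz ym; apply/asboolP; exists (lev z), (y - z).
  by split; [|exact: bounded|rewrite addrC subrK].
exists A; split=> //; split.
  move=> h; have [n <-] := gsurj h; apply: avoidable_not_recurrence.
  have [bohr_av _ _] := bohrP n.
  by apply: (translates_avoidable bohr_av _ (AE n)).
exists Phi; split=> //.
by rewrite /upper_density (cvg_limn_inf_sup Ac).2.
Qed.
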